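(* Let $c, k, n$ be positive integers such that $c \geq n+1$, $c \geq 2k+1$, $c \geq 5$, and $c+1 \leq n \cdot k$. Then the complete graph $K_c$ is not multiplicative; that is, there exist finite graphs $G$ and $H$ such that $\chi(G) > c$ and $\chi(H) > c$, yet $\chi(G \times H) \leq c$.
   Context: $K_c$ is the complete graph on $c$ vertices, and $\chi$ denotes the chromatic number. The tensor product $G \times H$ is the graph with vertex set $V(G) \times V(H)$ in which $(g,h)$ and $(g',h')$ are adjacent if and only if $gg' \in E(G)$ and $hh' \in E(H)$. A graph $K$ is multiplicative if, for all finite graphs $G, H$, the existence of a homomorphism $G \times H \to K$ implies that there is a homomorphism $G \to K$ or a homomorphism $H \to K$. The graphs $G$ and $H$ are understood to be undirected and loopless. *)

(* Defs.v *)
From mathcomp Require Import all_boot.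

Set Implicit Arguments.
Unset Strict Implicit.
Unset Printing Implicit Defensive.

(* Finite undirected loopless graphs. *)
Record sgraph := SGraph {
  vertex :> finType;
  edge : rel vertex;
  edge_sym : symmetric edge;
  edge_irr : irreflexive edge }.

Definition is_hom (G K : sgraph) (f : G -> K) : Prop :=
  forall x y : G, edge x y -> edge (f x) (f y).

Definition hom_exists (G K : sgraph) : Prop := exists f : G -> K, is_hom f.

Definition complete_edge (c : nat) : rel 'I_c := fun i j => i != j.

Lemma complete_edge_sym (c : nat) : symmetric (@complete_edge c).
Proof. by move=> i j; rewrite /complete_edge eq_sym. Qed.

Lemma complete_edge_irr (c : nat) : irreflexive (@complete_edge c).
Proof. by move=> i; rewrite /complete_edge eqxx. Qed.

Definition complete_graph (c : nat) : sgraph :=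
  SGraph (@complete_edge_sym c) (@complete_edge_irr c).

Definition tensor_edge (G H : sgraph) : rel (G * H) :=
  fun p q => edge p.1 q.1 && edge p.2 q.2.

Lemma tensor_edge_sym (G H : sgraph) : symmetric (@tensor_edge G H).
Proof.
by move=> p q; rewrite /tensor_edge (edge_sym p.1) (edge_sym p.2).
Qed.

Lemma tensor_edge_irr (G H : sgraph) : irreflexive (@tensor_edge G H).
Proof. by move=> p; rewrite /tensor_edge edge_irr. Qed.

Definition tensor (G H : sgraph) : sgraph :=
  SGraph (@tensor_edge_sym G H) (@tensor_edge_irr G H).

Definition multiplicative (K : sgraph) : Prop :=
  forall G H : sgraph,
    hom_exists (tensor G H) K -> hom_exists G K \/ hom_exists H K.

Definition proper_coloring (G : sgraph) (n : nat) (f : G -> 'I_n) : bool :=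
  [forall x, forall y, edge x y ==> (f x != f y)].

Definition colorable (G : sgraph) (n : nat) : bool :=
  [exists f : {ffun G -> 'I_n}, proper_coloring f].

Lemma colorable_ex (G : sgraph) : exists n, colorable G n.
Proof.
exists #|G|; apply/existsP; exists [ffun x => enum_rank x].
apply/forallP=> x; apply/forallP=> y; apply/implyP=> xy; rewrite !ffunE.
by apply: contraTneq xy => /enum_rank_inj ->; rewrite edge_irr.
Qed.

Definition chromatic_number (G : sgraph) : nat := ex_minn (colorable_ex G).

(* Main.v *)
Require Import Defs.
From mathcomp Require Import all_boot.
From mathcomp Require Import fingroup perm.
From mathcomp Require Import zify.

Set Implicit Arguments.
Unset Strict Implicit.
Unset Printing Implicit Defensive.

(** For each [c >= 5] the two factors are a graph [G] with chromatic number
    greater than [c] and the exponential graph [K_c^G], whose vertices are all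
    maps [G -> K_c] and where [f] and [g] are adjacent when [f u <> g v] for
    every edge [uv].  Evaluation [(u, f) |-> f u] colours [G x K_c^G] with [c]
    colours, so everything rests on choosing [G] such that neither [G] nor
    [K_c^G] is [c]-colourable.

    The graph [G] must be globally complicated and locally bipartite: it is
    covered by [c] sets, each of which has a bipartite neighbourhood of large
    radius, and yet it is not [c]-colourable.  Fine Borsuk graphs of a sphere
    behave like this.  The discrete version [block_graph] has as vertices the
    vectors over [{+, -, 0}] that alternate in sign almost everywhere, and it
    joins [x] to [y] when [x] and [-y] are comparable.  Its chromatic number
    is bounded below with the octahedral Tucker lemma ([octahedral_tucker]),
    which is proved with Ky Fan's parity count of alternating flags.  If the
    coordinates are cut into [c] long blocks, then a vertex has fewer than [c]
    defects, so it alternates perfectly on some block ([part_cover]); near such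
    a vertex, the phase of the alternation on that block is well defined and
    flips along every edge ([side_edge]).

    To see that [K_c^G] is not [c]-colourable ([exp_graph_not_colorable]),
    suppose that [Psi] colours it, normalised so that the constant map [d] has
    colour [d].  Then [Psi f] is always a value of [f].  Call a set [X] of
    vertices big when every map that is [d] on [X] and [s] off [X] has colour
    [d].  The whole vertex set is big, and if a union of two sets is big then a
    neighbourhood of bounded radius of one of the two is big ([big_split]);
    iterating over the cover, the neighbourhood of one of the [c] sets is big,
    and its surroundings are bipartite.  But a bipartite neighbourhood of a
    set [X] prevents it from being big ([big_not_bipartite]): colour the
    neighbourhood properly with [p] and [q], and the rest with a colour [t].
    For the different [t] these maps form a clique of size at least three;
    none of them gets its colour [t], because a big set sees only [p] and [q];
    so three pairwise different colours lie in [{p, q}]. *)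

(** * Octahedral Tucker lemma *)

Fixpoint alternates (p : bool) (w : seq bool) : bool :=
  if w is a :: w' then (a != p) && alternates a w' else true.

Lemma alternates_negb p w : alternates p (map negb w) = alternates (~~ p) w.
Proof.
elim: w p => //= a w IHw p; rewrite IHw negbK.
by case: a; case: p.
Qed.

(** Deleting one letter from a word leaves an alternating word with prescribed
    first letter in exactly one way if the word alternates, and in zero or two
    ways otherwise.  This is the combinatorial heart of Fan's parity count. *)
Lemma alternates_facets (T : eqType) (f : T -> bool) p (rs : seq T) :
    uniq rs -> rs != [::] ->
  \big[addb/false]_(r <- rs) alternates p (map f (filter (predC1 r) rs)) =
  alternates false (map f rs) (+) alternates true (map f rs).
Proof.
elim: rs p => // a s IHs p /= /andP[aNs uniq_s] _; rewrite big_cons /= eqxx /=.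
have fil_s : filter (predC1 a) s = s.
  by apply/all_filterP/allP=> x xs /=; apply: contraNneq aNs => <-.
rewrite fil_s.
have -> : \big[addb/false]_(r <- s)
      alternates p [seq f i | i <- if a != r then a :: filter (predC1 r) s
                                   else filter (predC1 r) s] =
    (f a != p) &&
      \big[addb/false]_(r <- s) alternates (f a) (map f (filter (predC1 r) s)).
  rewrite (big_morph (andb (f a != p)) (id1 := false) (op1 := addb)) ?andbF //;
    last exact: andb_addr.
  apply: eq_big_seq => r rs; rewrite (_ : a != r) //=.
  by apply: contraNneq aNs => ->.
case: (eqVneq s [::]) => [->|s0]; first by rewrite big_nil /= andbF; case: (f a).
by rewrite (IHs _ uniq_s s0); case: (f a); case: p;
  case: (alternates false _); case: (alternates true _).
Qed.

Lemma big_addb_cancel (T : finType) (P F q : pred T) (h : T -> T) :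
    involutive h -> (forall x, P x -> P (h x)) ->
    (forall x, P x -> F (h x) = F x) -> (forall x, P x -> q (h x) = ~~ q x) ->
  \big[addb/false]_(x | P x) F x = false.
Proof.
move=> hK hP hF hq; rewrite (bigID q) /=.
rewrite [X in _ (+) X](reindex_inj (inv_inj hK)) /=.
have PhE x : P (h x) = P x by apply/idP/idP => [/hP|/hP //]; rewrite hK.
rewrite [X in _ (+) X](eq_big (fun x => P x && q x) F) ?addbb // => x.
  by rewrite PhE; case Px: (P x); rewrite //= hq // negbK.
by rewrite PhE => /andP[Px _]; apply: hF.
Qed.

(** Faces of the cross-polytope; [None] stands for a zero coordinate. *)
Definition signvec n := {ffun 'I_n -> option bool}.

Definition oppv n (x : signvec n) : signvec n := [ffun i => omap negb (x i)].

Definition zerov n : signvec n := [ffun=> None].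

Definition lev n (x y : signvec n) : bool :=
  [forall i, (x i == None) || (x i == y i)].

Section OctahedralTucker.

Variables (n : nat) (lab : signvec n -> nat) (sg : signvec n -> bool).
Hypothesis lab_opp : forall x, lab (oppv x) = lab x.
Hypothesis sg_opp : forall x, x != zerov n -> sg (oppv x) = ~~ sg x.

(** A maximal chain of sign vectors, encoded by the rank at which each
    coordinate becomes nonzero and by the sign it then takes. *)
Definition flag := ({perm 'I_n} * {ffun 'I_n -> bool})%type.

Implicit Types (F : flag).

Definition flagvec F r : signvec n :=
  [ffun i => if F.1 i < r then Some (F.2 i) else None].

Definition flagvecs F (rs : seq nat) : seq (signvec n) :=
  sort (relpre lab leq) [seq flagvec F r | r <- rs].

(** The signs of the labels along the chosen ranks, read in increasing order of
    the absolute values of the labels. *)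
Definition flagword F rs : seq bool := map sg (flagvecs F rs).

(** Maximal chains of the face spanned by the first [k] coordinates; the
    data at the other coordinates, which ranks up to [k] never read, is
    frozen so that each chain is represented once. *)
Definition in_face k : pred flag :=
  fun F => [forall i : 'I_n, (k <= i) ==> (F.1 i == i) && F.2 i].

Definition fan_parity k : bool :=
  \big[addb/false]_(F | in_face k F) alternates false (flagword F (iota 1 k)).

Lemma in_faceP k F :
  reflect (forall i : 'I_n, k <= i -> F.1 i = i /\ F.2 i) (in_face k F).
Proof.
apply: (iffP forallP) => FP i; first by move/(implyP (FP i))/andP=> [/eqP].
by apply/implyP=> /FP[-> ->]; rewrite eqxx.
Qed.

Lemma in_face_lt k F (i : 'I_n) : in_face k F -> F.1 i < k -> i < k.
Proof.
move/in_faceP=> FP; apply: contraTT; rewrite -!leqNgt => ki.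
by have [-> _] := FP i ki.
Qed.

Lemma flagvec_neq0 F r : 0 < r <= n -> flagvec F r != zerov n.
Proof.
case/andP=> r0 rn; apply/eqP=> /ffunP E.
have n0 : 0 < n by apply: leq_trans rn.
have := E ((F.1)^-1 (Ordinal n0))%g.
by rewrite !ffunE permKV /= r0.
Qed.

Lemma flagword_facets F k : 0 < k ->
  \big[addb/false]_(r <- iota 1 k)
     alternates false (flagword F (filter (predC1 r) (iota 1 k))) =
  alternates false (flagword F (iota 1 k)) (+)
  alternates true (flagword F (iota 1 k)).
Proof.
move=> k0; pose leR := relpre (flagvec F) (relpre lab leq).
have wordE rs : flagword F rs = [seq sg (flagvec F r) | r <- sort leR rs].
  by rewrite /flagword /flagvecs sort_map -map_comp.
have tot : total leR by move=> x y; apply: leq_total.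
have tr : transitive leR by move=> x y z; apply: leq_trans.
rewrite !wordE -(@alternates_facets _ (fun r => sg (flagvec F r)) false).
- under eq_bigr do rewrite wordE -(filter_sort tot tr).
  by apply: perm_big; rewrite perm_sym perm_sort.
- by rewrite sort_uniq iota_uniq.
by rewrite -size_eq0 size_sort size_iota -lt0n.
Qed.

(** The antipode exchanges the two hemispheres of the face, cut out by the sign
    of its last coordinate [o], and turns words that alternate from one sign
    into words that alternate from the other. *)
Lemma fan_antipodal k : k < n ->
  forall o : 'I_n, val o = k ->
  fan_parity k.+1 =
  \big[addb/false]_(F | in_face k.+1 F && F.2 o)
    (alternates false (flagword F (iota 1 k.+1)) (+)
     alternates true (flagword F (iota 1 k.+1))).
Proof.
move=> kn o ok; rewrite big_split /= /fan_parity (bigID (fun F : flag => F.2 o)) /=.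
congr (_ (+) _).
pose h F : flag := (F.1, [ffun i : 'I_n => F.2 i (+) (i < k.+1)]).
have hK : involutive h.
  by case=> r s; congr (_, _); apply/ffunP=> i; rewrite !ffunE addbK.
rewrite (reindex_inj (inv_inj hK)) /=.
have hface F : in_face k.+1 (h F) = in_face k.+1 F.
  apply: eq_forallb => i; case: leqP => //= ki.
  by rewrite ffunE ltnNge ki addbF.
apply: eq_big => [F|F]; first by rewrite hface ffunE ok leqnn addbT negbK.
rewrite hface => /andP[Fk _]; rewrite /flagword.
suff -> : flagvecs (h F) (iota 1 k.+1) = map (@oppv n) (flagvecs F (iota 1 k.+1)).
  rewrite -map_comp -(alternates_negb false) -map_comp; congr alternates.
  apply/eq_in_map => x; rewrite mem_sort => /mapP[r].
  rewrite mem_iota => /andP[r0 rk] ->{x}; rewrite /= sg_opp //.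
  by apply: flagvec_neq0; lia.
rewrite /flagvecs (map_sort (leT := relpre lab leq)); last first.
  by move=> x y /=; rewrite !lab_opp.
rewrite -map_comp; congr sort; apply/eq_in_map => r.
rewrite mem_iota => /andP[_ rk]; apply/ffunP=> i; rewrite /= !ffunE /=.
case: ifP => //= ir; rewrite ?ffunE (_ : i < k.+1) ?addbT //.
by apply: (in_face_lt Fk); apply: leq_trans ir _; lia.
Qed.

(** A chain with an interior rank deleted has exactly two completions, both in
    the same hemisphere: exchange the two coordinates that
    appear between the neighbouring ranks.  Facets of this kind cancel. *)
Lemma fan_swap k r (o : 'I_n) : val o = k -> 0 < r <= k ->
  \big[addb/false]_(F | in_face k.+1 F && F.2 o)
     alternates false (flagword F (filter (predC1 r) (iota 1 k.+1))) = false.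
Proof.
move=> ok /andP[r0 rk]; have kn : k < n by rewrite -ok ltn_ord.
have an : r.-1 < n by lia.
have bn : r < n by lia.
pose a := Ordinal an; pose b := Ordinal bn.
pose h F : flag := ((F.1 * tperm a b)%g, F.2).
have hK : involutive h.
  by case=> p s; congr (_, _); rewrite -mulgA tperm2 mulg1.
apply: (big_addb_cancel (h := h)
  (q := fun F => (F.1^-1)%g a < (F.1^-1)%g b)) => // F.
- case/andP=> /in_faceP Fk -> /=; rewrite andbT; apply/in_faceP=> i ki.
  have [Fi si] := Fk i ki; split=> //=; rewrite permM Fi tpermD //.
    by apply/eqP=> E; move: ki; rewrite -E /=; lia.
  by apply/eqP=> E; move: ki; rewrite -E /=; lia.
- move=> _; congr alternates; rewrite /flagword /flagvecs; congr (map _ (sort _ _)).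
  apply/eq_in_map => q; rewrite mem_filter /= => /andP[qr _].
  apply/ffunP=> i; rewrite !ffunE /= permM; congr (if _ then _ else _).
  by case: tpermP => [->|->|] //=; lia.
move=> _; rewrite /= !invMg !permM tpermV tpermL tpermR.
have: (F.1^-1)%g a != (F.1^-1)%g b.
  by rewrite (inj_eq perm_inj) -(inj_eq val_inj) /=; lia.
by rewrite -(inj_eq val_inj) /=; case: ltngtP.
Qed.

(** A chain with its top deleted has two completions, by the two signs of the
    missing coordinate; both lie in the hemisphere, and cancel, unless that
    coordinate is the one that defines the hemisphere.  The chains that remain
    are those of the equator. *)
Lemma fan_boundary k (o : 'I_n) : val o = k ->
  \big[addb/false]_(F | in_face k.+1 F && F.2 o)
     alternates false (flagword F (filter (predC1 k.+1) (iota 1 k.+1))) =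
  fan_parity k.
Proof.
move=> ok.
have -> : filter (predC1 k.+1) (iota 1 k.+1) = iota 1 k.
  rewrite -addn1 iotaD filter_cat /= add1n addn1 eqxx /= cats0.
  by apply/all_filterP/allP=> r; rewrite mem_iota /=; lia.
rewrite (bigID (fun F : flag => F.1 o == o)) /= addbC.
rewrite [X in X (+) _](_ : _ = false) /=.
  apply: eq_bigl => F; apply/andP/in_faceP=> [[/andP[/in_faceP Fk so] /eqP Fo] i|Fk].
    rewrite leq_eqVlt -ok => /orP[/eqP/val_inj <-|]; first by split.
    by rewrite ok; apply: Fk.
  have [Fo so] := Fk o (eq_leq (esym ok)); rewrite Fo so eqxx andbT; split=> //.
  by apply/in_faceP=> i ki; apply: Fk; apply: ltnW.
pose top F : 'I_n := (F.1^-1)%g o.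
pose h F : flag := (F.1, [ffun i => F.2 i (+) (i == top F)]).
have hK : involutive h.
  by case=> p s; congr (_, _); apply/ffunP=> i; rewrite !ffunE addbK.
have topE F : F.1 (top F) = o by rewrite permKV.
apply: (big_addb_cancel (h := h) (q := fun F => F.2 (top F))) => // F.
- case/andP=> /andP[/in_faceP Fk so] Fo.
  have oNtop : o != top F by apply: contraNneq Fo => {1}->; rewrite topE.
  rewrite ffunE (negbTE oNtop) so Fo !andbT; apply/in_faceP=> i ki.
  have [Fi si] := Fk i ki; split=> //=; rewrite ffunE si.
  suff /negbTE-> : i != top F by [].
  apply/eqP=> E; move: Fi; rewrite E topE -E => oi.
  by move: ki; rewrite -oi ok ltnn.
- move=> _; congr alternates; rewrite /flagword /flagvecs; congr (map _ (sort _ _)).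
  apply/eq_in_map => q; rewrite mem_iota => /andP[_ qk].
  apply/ffunP=> i; rewrite !ffunE; case: ifP => //= iq; rewrite ?ffunE.
  suff /negbTE-> : i != top F by rewrite addbF.
  by apply: contraTneq iq => ->; rewrite topE ok; lia.
by move=> _; rewrite ffunE eqxx addbT.
Qed.

(** The number of positively alternating maximal chains has the same parity in
    every dimension: count incidences of alternating facets with maximal
    chains of a hemisphere, first by chains and then by facets. *)
Lemma fan_parity_odd k : k <= n -> fan_parity k.
Proof.
elim: k => [_|k IHk kn].
  rewrite /fan_parity (big_pred1 (1%g, [ffun=> true])) // => -[p s] /=.
  rewrite xpair_eqE; apply/in_faceP/andP=> [F0|[/eqP-> /eqP->] i _].
    split; apply/eqP; first by apply/permP=> i; rewrite perm1; case: (F0 i).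
    by apply/ffunP=> i; rewrite ffunE; case: (F0 i).
  by rewrite perm1 ffunE.
pose o := Ordinal kn; rewrite (fan_antipodal kn (o := o)) //.
under eq_bigr do rewrite -flagword_facets //.
have kin : k.+1 \in iota 1 k.+1 by rewrite mem_iota; lia.
rewrite exchange_big (bigD1_seq k.+1 kin (iota_uniq _ _)).
rewrite (fan_boundary (o := o)) // IHk ?(ltnW kn) //.
rewrite big1_seq // => r; rewrite mem_iota => /andP[rNk rk].
by rewrite (fan_swap (o := o)) //; lia.
Qed.

Lemma lev_flagvec F r q : r <= q -> lev (flagvec F r) (flagvec F q).
Proof.
move=> rq; apply/forallP=> i; rewrite !ffunE; case: ifP => //= ir.
by rewrite (leq_trans ir rq).
Qed.

Lemma alternates_ltn (v : signvec n) (vs : seq (signvec n)) :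
    {in v :: vs &, forall x y, lab x = lab y -> sg x = sg y} ->
    path (relpre lab leq) v vs -> alternates (sg v) (map sg vs) ->
  path (relpre lab ltn) v vs.
Proof.
elim: vs v => //= w vs IHvs v same /andP[vw pw] /andP[wNv aw].
rewrite IHvs //; last by move=> x y xs ys; apply: same; rewrite inE ?xs ?ys orbT.
rewrite andbT ltn_neqAle vw andbT; apply: contraNneq wNv => E.
by rewrite (same w v) // !inE eqxx ?orbT.
Qed.

(** A chain of [n] vectors whose labels alternate in sign along increasing
    absolute values exists by parity; equal absolute values with opposite
    signs are excluded inside a chain, so its [n] absolute values are
    distinct. *)
Theorem octahedral_tucker m :
    (forall x, x != zerov n -> lab x < m) ->
    (forall x y, x != zerov n -> lev x y -> lab x = lab y -> sg x = sg y) ->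
  n <= m.
Proof.
move=> lab_lt same.
have [F alt] : exists F, alternates false (flagword F (iota 1 n)).
  case: (pickP (fun F => alternates false (flagword F (iota 1 n)))) => [F|no].
    by exists F.
  by have := fan_parity_odd (leqnn n); rewrite /fan_parity big1.
pose vs := flagvecs F (iota 1 n).
have vsP x : x \in vs -> exists2 r, 0 < r <= n & x = flagvec F r.
  rewrite mem_sort => /mapP[r]; rewrite mem_iota => rn ->; exists r => //; lia.
have vs_same : {in vs &, forall x y, lab x = lab y -> sg x = sg y}.
  move=> _ _ /vsP[r rn ->] /vsP[q qn ->] E.
  have [rq|/ltnW qr] := leqP r q.
    by apply: same E; rewrite ?flagvec_neq0 ?lev_flagvec.
  by apply/esym; apply: same (esym E); rewrite ?flagvec_neq0 ?lev_flagvec.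
have vs_sorted : sorted (relpre lab ltn) vs.
  have tot : total (relpre lab leq) by move=> x y; apply: leq_total.
  have := sort_sorted tot [seq flagvec F r | r <- iota 1 n].
  move: vs_same alt; rewrite /flagword -/(flagvecs F (iota 1 n)) -/vs.
  case: vs {vsP} => //= v s vs_same /andP[_ alt] vs_path.
  exact: alternates_ltn.
have uniq_lab : uniq (map lab vs).
  by apply: (sorted_uniq ltn_trans ltnn); rewrite sorted_map.
have := uniq_leq_size (s2 := iota 0 m) uniq_lab.
rewrite size_map size_sort size_map !size_iota; apply=> _ /mapP[x /vsP[r rn ->] ->].
by rewrite mem_iota /= lab_lt ?flagvec_neq0.
Qed.

End OctahedralTucker.

(** * Neighbourhoods in a graph *)

Definition nbhd (G : sgraph) (X : {set G}) : {set G} :=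
  [set v | (v \in X) || [exists u in X, edge u v]].

Lemma nbhd_edge (G : sgraph) (X : {set G}) u v :
  u \in X -> edge u v -> v \in nbhd X.
Proof.
by move=> uX uv; rewrite inE; apply/orP; right; apply/existsP; exists u; rewrite uX.
Qed.

Lemma sub_nbhd (G : sgraph) (X : {set G}) : X \subset nbhd X.
Proof. by apply/subsetP=> v vX; rewrite inE vX. Qed.

Lemma nbhdS (G : sgraph) (X Y : {set G}) :
  X \subset Y -> nbhd X \subset nbhd Y.
Proof.
move=> /subsetP sXY; apply/subsetP=> v; rewrite !inE => /orP[/sXY-> //|].
case/existsP=> u /andP[/sXY uY uv]; apply/orP; right.
by apply/existsP; exists u; rewrite uY.
Qed.

Lemma nbhdU (G : sgraph) (X Y : {set G}) :
  nbhd (X :|: Y) \subset nbhd X :|: nbhd Y.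
Proof.
apply/subsetP=> v; rewrite inE in_setU => /orP[/orP[vX|vY]|].
- by rewrite in_setU (subsetP (sub_nbhd _) _ vX).
- by rewrite in_setU (subsetP (sub_nbhd _) _ vY) orbT.
case/existsP=> u /andP[]; rewrite in_setU => /orP[uX|uY] uv; rewrite in_setU.
  by rewrite (nbhd_edge uX uv).
by rewrite (nbhd_edge uY uv) orbT.
Qed.

Lemma iter_nbhdU (G : sgraph) m (X Y : {set G}) :
  iter m (@nbhd G) (X :|: Y) \subset iter m (@nbhd G) X :|: iter m (@nbhd G) Y.
Proof.
elim: m => // m IHm; rewrite !iterS.
exact: subset_trans (nbhdS IHm) (nbhdU _ _).
Qed.

(** * The block graph *)

(** The length of a longest alternating subsequence of nonzero entries whose
    first sign differs from [p]. *)
Fixpoint alt (p : bool) (w : seq (option bool)) : nat :=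
  match w with
  | [::] => 0
  | None :: w' => alt p w'
  | Some a :: w' => if a == p then alt p w' else (alt a w').+1
  end.

Lemma alt_step p q w : alt p w <= (alt q w).+1.
Proof.
elim: w p q => // -[a|] w IHw p q /=; last exact: IHw.
case: eqP => [->|_]; case: eqP => [->|_] //; first exact: leqW.
Qed.

Lemma alt_neq w : has isSome w -> alt true w != alt false w.
Proof.
elim: w => // -[[]|] w IHw //= hw; lia.
Qed.

Lemma alt_negb p w : alt p (map (omap negb) w) = alt (~~ p) w.
Proof.
by elim: w p => // -[a|] w IHw p //=; rewrite !IHw negbK; case: a; case: p.
Qed.

Lemma alt_le (I : eqType) (x y : I -> option bool) p (s : seq I) :
    {in s, forall i, x i = None \/ x i = y i} ->
  alt p (map x s) <= alt p (map y s).
Proof.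
elim: s p => //= i s IHs p xy.
have IH q : alt q (map x s) <= alt q (map y s).
  by apply: IHs => k ks; apply: xy; rewrite inE ks orbT.
have [->|->] := xy i (mem_head _ _); last first.
  by case: (y i) => [a|] //; case: ifP => // _; apply: IH.
case: (y i) => [a|] //; case: ifP => // _.
by apply: leq_trans (alt_step p a _) _; apply: IH.
Qed.

Lemma alt_count p w : alt p w <= count isSome w.
Proof.
elim: w p => // -[a|] w IHw p /=; last exact: IHw.
by case: ifP => _; [apply: leq_trans (IHw p) _; rewrite leq_addl | apply: IHw].
Qed.

Lemma alt_cat m p w1 w2 :
  (forall q, alt q w2 <= m) -> alt p (w1 ++ w2) <= alt p w1 + m.
Proof.
move=> w2m; elim: w1 p => [|[a|] w1 IHw] p //=.
by case: ifP => _; rewrite ?addSn ?ltnS; apply: IHw.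
Qed.

Lemma alt_full p (f : nat -> option bool) a l :
    alt p (map f (iota a l)) = l ->
  count (fun i => f i == Some (~~ p (+) odd a (+) odd i)) (iota a l) = l.
Proof.
elim: l a p => //= l IHl a p.
have le_l q : alt q (map f (iota a.+1 l)) <= l.
  apply: leq_trans (alt_count _ _) _.
  by apply: leq_trans (count_size _ _) _; rewrite size_map size_iota.
case: (f a) => [b|] E; last by have := le_l p; rewrite E ltnn.
case: (eqVneq b p) E => [-> E|bp [E]]; first by have := le_l p; rewrite E ltnn.
have bE : b = ~~ p by case: b p bp {E} => [] [].
rewrite addbK bE eqxx add1n; congr _.+1; rewrite bE in E.
rewrite -[RHS](IHl _ _ E); apply: eq_count => i /=.
by rewrite negbK addbN addNb.
Qed.

(** Reading coordinates by natural number lets blocks be intervals [iota a l]. *)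
Definition rd n (x : signvec n) (i : nat) : option bool :=
  if insub i is Some o then x o else None.

Lemma rd_opp n (x : signvec n) i : rd (oppv x) i = omap negb (rd x i).
Proof. by rewrite /rd; case: insub => // o; rewrite ffunE. Qed.

Lemma oppvK n : involutive (@oppv n).
Proof. by move=> x; apply/ffunP=> i; rewrite !ffunE; case: (x i) => //= -[]. Qed.

Lemma lev_opp n (x y : signvec n) : lev (oppv x) (oppv y) = lev x y.
Proof.
by apply: eq_forallb => i; rewrite !ffunE; case: (x i) (y i) => [[]|] [[]|].
Qed.

Lemma rd_le n (x y : signvec n) i : lev x y -> rd x i = None \/ rd x i = rd y i.
Proof.
rewrite /rd; case: insub => [o|]; last by left.
by move/forallP/(_ o) => /orP[]/eqP->; [left | right].
Qed.

Definition altv n p (x : signvec n) := alt p (map (rd x) (iota 0 n)).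

Definition alts n (x : signvec n) := maxn (altv true x) (altv false x).

Lemma altv_opp n p (x : signvec n) : altv p (oppv x) = altv (~~ p) x.
Proof.
rewrite /altv -alt_negb -map_comp; congr alt.
by apply: eq_map => i /=; rewrite rd_opp.
Qed.

Lemma alts_opp n (x : signvec n) : alts (oppv x) = alts x.
Proof. by rewrite /alts !altv_opp maxnC. Qed.

Lemma altv_le n p (x y : signvec n) : lev x y -> altv p x <= altv p y.
Proof. by move=> xy; apply: alt_le => i _; apply: rd_le. Qed.

Lemma altv_neq n (x : signvec n) : x != zerov n -> altv true x != altv false x.
Proof.
move=> x0; apply: alt_neq; rewrite has_map; apply/hasP.
have [i xi] : exists i, x i != None.
  apply/existsP; apply: contraR x0; rewrite negb_exists => /forallP x0.
  by apply/eqP/ffunP=> i; rewrite ffunE; apply/eqP; have:= x0 i; rewrite negbK.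
exists (val i); first by rewrite mem_iota /= add0n ltn_ord.
by rewrite /= /rd valK; case: (x i) xi.
Qed.

Lemma alts_gt0 n (x : signvec n) : x != zerov n -> 0 < alts x.
Proof. by move/altv_neq; rewrite /alts; lia. Qed.

Definition zeros n (x : signvec n) := count (fun i => rd x i == None) (iota 0 n).

Lemma zeros_alts n (x : signvec n) : zeros x + alts x <= n.
Proof.
have H p : zeros x + altv p x <= n.
  rewrite -[leqRHS](size_iota 0) -(count_predC (fun i => rd x i == None)).
  rewrite leq_add2l; apply: leq_trans (alt_count _ _) _.
  by rewrite count_map; apply: sub_count => i /=; case: (rd x i).
by have:= H true; have:= H false; rewrite /alts; lia.
Qed.

Section BlockGraph.

Variables (c l : nat) (l_gt0 : 0 < l).
Let n := c * l.

(** [n - alts x] counts zeros and repeated signs, so a good vector has fewer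
    than [c] defects. *)
Definition good (x : signvec n) := n < alts x + c.

Definition good_vec := {x : signvec n | good x}.

Definition block_edge : rel good_vec :=
  fun u v => lev (val u) (oppv (val v)) || lev (val v) (oppv (val u)).

Lemma block_edge_sym : symmetric block_edge.
Proof. by move=> u v; rewrite /block_edge orbC. Qed.

Lemma good_neq0 x : good x -> x != zerov n.
Proof.
rewrite /good => gx; apply: contraTneq gx => ->.
have: alts (zerov n) = 0.
  have H p : altv p (zerov n) = 0.
    apply/eqP; rewrite -leqn0; apply: leq_trans (alt_count _ _) _.
    rewrite leqn0 -leqn0 leqNgt -has_count; apply/hasP=> -[o /mapP[i _ ->]].
    by rewrite /rd; case: insub => // k; rewrite ffunE.
  by rewrite /alts !H.
by move->; rewrite -leqNgt /n add0n; apply: leq_pmulr.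
Qed.

Lemma block_edge_irr : irreflexive block_edge.
Proof.
case=> x gx; rewrite /block_edge orbb /=; apply: contraNF (good_neq0 gx) => /forallP xx.
apply/eqP/ffunP=> i; rewrite ffunE; have:= xx i; rewrite ffunE.
by case: (x i) => [[]|].
Qed.

Definition block_graph := SGraph block_edge_sym block_edge_irr.

Lemma good_opp x : good (oppv x) = good x.
Proof. by rewrite /good alts_opp. Qed.

(** From a [c]-colouring, label a bad vector by its alternation number and a
    good vector [x] by the smaller of the colours of [x] and [-x], shifted
    beyond the alternation numbers of bad vectors.  Two colours of [c] differ,
    so the smaller one is not the last: only [n - 1] absolute values occur,
    against Tucker's lemma in dimension [n]. *)
Lemma block_graph_ncol : 0 < c -> ~~ colorable block_graph c.
Proof.
move=> c_gt0; apply/negP=> /existsP[kappa /forallP kappaP].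
pose col x : nat := if insub x is Some v then val (kappa v) else 0.
have colP x y : good x -> good y -> lev x (oppv y) -> col x != col y.
  move=> gx gy xy; rewrite /col !insubT /=.
  have /implyP := forallP (kappaP (Sub x gx)) (Sub y gy).
  by apply; rewrite /edge /= /block_edge /= xy.
have col_opp x : good x -> col x != col (oppv x).
  move=> gx; apply: colP; rewrite ?good_opp // oppvK.
  by apply/forallP=> i; rewrite eqxx orbT.
have col_lt x : col x < c by rewrite /col; case: insub => [v|] //; apply: ltn_ord.
pose lab x := if good x then n - c + minn (col x) (col (oppv x)) else (alts x).-1.
pose sg x := if good x then col x < col (oppv x) else altv true x < altv false x.
have n_ge : c <= n by rewrite /n; apply: leq_pmulr.
have lab_bad x : x != zerov n -> ~~ good x -> lab x < n - c.
  move=> x0 bx; rewrite /lab (negbTE bx); have:= alts_gt0 x0.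
  by move: bx; rewrite /good; lia.
suff: n <= n.-1 by lia.
apply: (@octahedral_tucker n lab sg).
- by move=> x; rewrite /lab good_opp alts_opp oppvK minnC.
- move=> x x0; rewrite /sg good_opp oppvK !altv_opp /=.
  case: ifP => [/col_opp | _]; first by case: ltngtP.
  by have := altv_neq x0; case: ltngtP.
- move=> x x0; case: (boolP (good x)) => [gx|/(lab_bad _ x0)]; last by lia.
  rewrite /lab gx; have:= col_opp _ gx; have:= col_lt x; have:= col_lt (oppv x); lia.
move=> x y x0 xy.
have y0 : y != zerov n.
  apply: contraNneq x0 => y0; apply/eqP/ffunP=> i; rewrite ffunE.
  by have := forallP xy i; rewrite y0 ffunE orbb => /eqP.
case: (boolP (good x)) => gx; case: (boolP (good y)) => gy.
- rewrite /lab /sg gx gy => /addnI E.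
  have := colP x (oppv y) gx; rewrite good_opp oppvK => /(_ gy xy) C1.
  have := colP (oppv x) y; rewrite good_opp lev_opp => /(_ gx gy xy) C2.
  by have := col_opp _ gx; have := col_opp _ gy; lia.
- by have := lab_bad _ y0 gy; rewrite [lab x]/lab gx; lia.
- by have := lab_bad _ x0 gx; rewrite [lab y]/lab gy; lia.
rewrite /lab /sg (negbTE gx) (negbTE gy).
have := alts_gt0 x0; have := alts_gt0 y0; have := altv_neq x0; have := altv_neq y0.
have := altv_le true xy; have := altv_le false xy; rewrite /alts.
have S p q (z : signvec n) : altv p z <= (altv q z).+1 by apply: alt_step.
have := S true false x; have := S false true x.
have := S true false y; have := S false true y.
lia.
Qed.

Definition block (j : 'I_c) := iota (j * l) l.

(** How far [x] agrees on block [j] with the perfect alternation of phase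
    [p]. *)
Definition matches p (x : signvec n) j :=
  count (fun i => rd x i == Some (p (+) odd i)) (block j).

Definition part (j : 'I_c) : {set block_graph} :=
  [set v : block_graph | (matches true (val v) j == l) || (matches false (val v) j == l)].

Definition side (j : 'I_c) (v : block_graph) : bool := l < 2 * matches true (val v) j.

(** If each of the [c] blocks contained a defect, then the alternation number
    would be at most [n - c]. *)
Lemma part_cover (v : block_graph) : exists j, v \in part j.
Proof.
case: v => x gx; suff [j [p /alt_full E]] :
    exists j : 'I_c, exists p, alt p (map (rd x) (block j)) = l.
  exists j; rewrite inE; apply/orP.
  by case: (~~ p (+) odd (j * l)) E => E; [left | right]; apply/eqP.
case: (pickP (fun j : 'I_c => [exists p, alt p (map (rd x) (block j)) == l])).
  by move=> j /existsP[p /eqP jp]; exists j, p.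
move=> notfull.
have short k : k <= c -> forall p, alt p (map (rd x) (iota 0 (k * l))) <= k * l.-1.
  elim: k => // k IHk kc p; rewrite !mulSnr iotaD map_cat.
  apply: leq_trans (alt_cat (m := l.-1) _ _ _) _; last first.
    by rewrite leq_add2r; apply: IHk (ltnW kc) _.
  move=> q; rewrite -ltnS prednK // ltn_neqAle.
  have /negbT := notfull (Ordinal kc); rewrite negb_exists => /forallP/(_ q) -> /=.
  apply: leq_trans (alt_count _ _) _.
  by apply: leq_trans (count_size _ _) _; rewrite size_map size_iota.
have := short c (leqnn c) true; have := short c (leqnn c) false.
have nE : n = c * l.-1 + c by rewrite /n -mulnSr prednK.
move: gx; rewrite /good /alts /altv -/n [X in X < _]nE => gx s1 s2.
by exfalso; lia.
Qed.

Lemma matches_opp p x j : matches p (oppv x) j = matches (~~ p) x j.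
Proof.
apply: eq_count => i /=; rewrite rd_opp.
by case: (rd x i) => [[]|]; case: p; case: (odd i).
Qed.

Lemma matches_le p (x y : signvec n) j : lev x y -> matches p x j <= matches p y j.
Proof.
by move=> xy; apply: sub_count => i /=; case: (rd_le i xy) => ->.
Qed.

Lemma matches_zeros p (x y : signvec n) j :
  lev x y -> matches p y j <= matches p x j + zeros x.
Proof.
move=> xy; have sub_zeros: count (fun i => rd x i == None) (block j) <= zeros x.
  rewrite /zeros -!size_filter; apply: uniq_leq_size.
    by rewrite filter_uniq ?iota_uniq.
  move=> i; rewrite !mem_filter !mem_iota => /and3P[-> _ ij] /=.
  apply: leq_trans ij _; rewrite add0n -mulSnr /n leq_mul2r; apply/orP; right.
  exact: ltn_ord.
apply: leq_trans (leq_add (leqnn _) sub_zeros).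
rewrite -count_predUI; apply: leq_trans (leq_addr _ _); apply: sub_count => i /=.
by case: (rd_le i xy) => -> // ->.
Qed.

(** Passing to a neighbour negates the vector up to filling in or erasing
    zeros, of which a good vector has fewer than [c]. *)
Lemma matches_edge (u v : block_graph) p j :
  edge u v -> matches p (val u) j <= matches (~~ p) (val v) j + c.
Proof.
move=> /orP[uv|vu].
  by apply: leq_trans (matches_le p j uv) _; rewrite matches_opp leq_addr.
have := matches_zeros (~~ p) j vu; rewrite matches_opp negbK.
move=> H; apply: leq_trans H _; rewrite leq_add2l.
by have := zeros_alts (val v); have := valP v; rewrite /good -/n;
  move: (zeros _) (alts _) => a b; lia.
Qed.

Lemma matches_ball r j (u : block_graph) :
    u \in iter r (@nbhd block_graph) (part j) ->
  exists p, l <= matches p (val u) j + r * c.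
Proof.
elim: r u => [|r IHr] u /=.
  by rewrite inE => /orP[]/eqP <-; [exists true | exists false]; rewrite addn0.
rewrite inE => /orP[/IHr[p pP]|/existsP[v /andP[/IHr[p pP] vu]]].
  by exists p; apply: leq_trans pP _; rewrite leq_add2l mulSn leq_addl.
exists (~~ p); apply: leq_trans pP _; rewrite mulSn addnA leq_add2r.
exact: matches_edge.
Qed.

Lemma matches_sum x j : matches true x j + matches false x j <= l.
Proof.
rewrite -count_predUI [X in _ + X](_ : _ = 0) ?addn0.
  by rewrite -[leqRHS](size_iota (j * l)) count_size.
by apply/eqP; rewrite -leqn0 leqNgt -has_count; apply/hasP=> -[i _ /andP[/eqP /= ->]];
  case: (odd i).
Qed.

(** Inside the ball of radius [r] around [part j] the agreement with one of the
    two phases stays above half the block length, so the majority phase is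
    well defined and flips along edges. *)
Lemma side_edge r j (u v : block_graph) :
    2 * (r + 1) * c < l -> u \in iter r (@nbhd block_graph) (part j) ->
  edge u v -> side j u != side j v.
Proof.
move=> rl /matches_ball[p pP] uv; have := matches_edge p j uv.
have := matches_sum (val u) j; have := matches_sum (val v) j.
move: rl pP; rewrite -mulnA mulnDl mul1n; move: (r * c) => rc.
by rewrite /side; case: p => /=; lia.
Qed.

End BlockGraph.

(** * Exponential graphs *)

Definition exp_edge (G : sgraph) (c : nat) : rel {ffun G -> 'I_c} :=
  fun f g => [forall u, forall v, edge u v ==> (f u != g v)].

Lemma exp_edgeP (G : sgraph) c (f g : {ffun G -> 'I_c}) :
  reflect (forall u v, edge u v -> f u != g v) (exp_edge f g).
Proof.
apply: (iffP forallP) => [fg u v | fg u].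
  by move/implyP: (forallP (fg u) v).
by apply/forallP=> v; apply/implyP; apply: fg.
Qed.

Lemma exp_edge_sym (G : sgraph) c : symmetric (@exp_edge G c).
Proof.
have sub f g : @exp_edge G c f g -> exp_edge g f.
  move/exp_edgeP=> fg; apply/exp_edgeP=> u v uv.
  by rewrite eq_sym fg // edge_sym.
by move=> f g; apply/idP/idP; apply: sub.
Qed.

Lemma exp_edge_irr (G : sgraph) c :
  ~~ colorable G c -> irreflexive (@exp_edge G c).
Proof.
move=> ncol f; apply: contraNF ncol => ff.
by apply/existsP; exists f.
Qed.

Definition exp_graph (G : sgraph) c (ncol : ~~ colorable G c) : sgraph :=
  SGraph (@exp_edge_sym G c) (exp_edge_irr ncol).

(** * Localisation of a colouring of the exponential graph *)

Section Localisation.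

Variables (G : sgraph) (c : nat) (c_ge5 : 4 < c).
Variable Psi : {ffun G -> 'I_c} -> 'I_c.
Hypothesis Psi_proper : forall f g, exp_edge f g -> Psi f != Psi g.
Hypothesis Psi_const : forall d, Psi [ffun=> d] = d.

Implicit Types (f g : {ffun G -> 'I_c}) (X Y Z : {set G}) (d s a : 'I_c).

Lemma fresh_colour (l : seq 'I_c) : size l < 5 -> exists d, d \notin l.
Proof.
move=> sz; case: (pickP [pred d | d \notin l]) => [d dl|all]; first by exists d.
have: #|'I_c| <= size l.
  apply: leq_trans (card_size l); apply: subset_leq_card.
  by apply/subsetP=> d _; have /negbFE := all d.
by rewrite card_ord; lia.
Qed.

(** Otherwise [f] is adjacent to the constant map [Psi f], of the same colour. *)
Lemma Psi_image f : exists v, f v = Psi f.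
Proof.
have: ~~ exp_edge f [ffun=> Psi f].
  by apply: contraL (eqxx (Psi f)) => /Psi_proper; rewrite Psi_const.
rewrite negb_forall => /existsP[u]; rewrite negb_forall => /existsP[v].
by rewrite negb_imply ffunE negbK => /andP[_ /eqP]; exists u.
Qed.

Definition two X d s : {ffun G -> 'I_c} := [ffun v => if v \in X then d else s].

(** The two-valued map is adjacent to [f]: the only colour they share is
    [Psi f], and its supports in the two maps are not joined by an edge. *)
Lemma grow f X s :
    (forall v, f v = Psi f -> v \in X) -> (forall v, f v != s) ->
  Psi (two (nbhd X) s (Psi f)) = s.
Proof.
move=> fX fs; have /Psi_proper: exp_edge f (two (nbhd X) s (Psi f)).
  apply/exp_edgeP=> u v uv; rewrite ffunE.
  case: ifPn => [_|vX]; first exact: fs.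
  by apply: contraNneq vX => /fX uX; apply: nbhd_edge uX uv.
have [v] := Psi_image (two (nbhd X) s (Psi f)).
by rewrite {1}ffunE; case: ifP => _ <- //; rewrite eqxx.
Qed.

Lemma two_grow X d s a :
    Psi (two X d s) = d -> d != s -> a != d -> a != s ->
  Psi (two (nbhd X) a d) = a.
Proof.
move=> Pd ds ad a_s; rewrite -[in two _ _ _]Pd; apply: grow => v; rewrite ffunE.
  by rewrite Pd; case: ifP => // _ /eqP; rewrite eq_sym (negbTE ds).
by case: ifP => _; rewrite eq_sym.
Qed.

(** If [Psi] were evaluation at a vertex, then the big sets would be those that
    contain it. *)
Definition big X := forall d s, d != s -> Psi (two X d s) = d.

Lemma big_nbhd X : big X -> big (nbhd X).
Proof.
move=> bX a d ad; have [|s] := @fresh_colour [:: a; d] => //.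
rewrite !inE negb_or => /andP[sa sd].
by apply: (@two_grow X d s a); rewrite ?bX // eq_sym.
Qed.

Lemma big_iter m X : big X -> big (iter m (@nbhd G) X).
Proof. by move=> bX; elim: m => //= m; apply: big_nbhd. Qed.

(** One favourable pair of colours spreads to all pairs: each enlargement
    replaces [(d, s)] by [(a, d)] with [a] new, and with five colours any
    ordered pair is reached in four such steps. *)
Lemma big_of_two X d s :
  Psi (two X d s) = d -> d != s -> big (iter 4 (@nbhd G) X).
Proof.
move=> Pd ds a b ab.
have [|x] := @fresh_colour [:: d; s; b] => //.
rewrite !inE !negb_or => /and3P[xd xs xb].
have [|y] := @fresh_colour [:: d; x; b; a] => //.
rewrite !inE !negb_or => /and4P[yd yx yb ya].
have P1 := two_grow Pd ds xd xs.
have P2 := two_grow P1 xd yx yd.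
have P3 : Psi (two (nbhd (nbhd (nbhd X))) b y) = b.
  by apply: (two_grow P2); rewrite // eq_sym.
apply: (two_grow P3); rewrite // eq_sym //.
Qed.

(** Colour a neighbourhood of [Y] with [a1], the rest of a neighbourhood of [Z]
    with [a2] and everything else with [a3].  The map that is [a3] on [X] and
    [a4] elsewhere is adjacent to this one, which excludes the colour [a3]. *)
Lemma big_split X Y Z :
    big X -> X \subset Y :|: Z ->
  big (iter 6 (@nbhd G) Y) \/ big (iter 6 (@nbhd G) Z).
Proof.
move=> bX /subsetP sX.
have [|a1 _] := @fresh_colour [::] => //.
have [|a2] := @fresh_colour [:: a1] => //; rewrite !inE => a21.
have [|a3] := @fresh_colour [:: a1; a2] => //.
rewrite !inE !negb_or => /andP[a31 a32].
have [|a4] := @fresh_colour [:: a1; a2; a3] => //.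
rewrite !inE !negb_or => /and3P[a41 a42 a43].
pose f : {ffun G -> 'I_c} :=
  [ffun v => if v \in nbhd Y then a1 else if v \in nbhd Z then a2 else a3].
have f4 v : f v != a4 by rewrite ffunE; do 2?case: ifP => _; rewrite eq_sym.
have Pf3 : Psi f != a3.
  have Pg : Psi (two X a3 a4) = a3 by rewrite bX // eq_sym.
  rewrite -Pg; apply: Psi_proper; apply/exp_edgeP=> u v uv.
  rewrite [X in _ != X]ffunE; case: ifPn => [vX|_]; last exact: f4.
  have vu : edge v u by rewrite edge_sym.
  have:= sX _ vX; rewrite in_setU ffunE => /orP[vY|vZ].
    by rewrite (nbhd_edge vY vu) eq_sym.
  by rewrite (nbhd_edge vZ vu); case: ifP; rewrite eq_sym.
have [v fv] := Psi_image f.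
have{v fv} : Psi f = a1 \/ Psi f = a2.
  move: fv Pf3; rewrite ffunE; case: ifP => _; first by left.
  by case: ifP => _ <-; [right | rewrite eqxx].
case=> Pf; [left | right].
  have Pg : Psi (two (nbhd (nbhd Y)) a4 (Psi f)) = a4.
    apply: grow f4 => v; rewrite Pf ffunE; case: ifP => // _; case: ifP => _ E.
      by rewrite E eqxx in a21.
    by rewrite E eqxx in a31.
  by rewrite -[6]/(4 + 2) iterD; apply: big_of_two Pg _; rewrite Pf.
have Pg : Psi (two (nbhd (nbhd Z)) a4 (Psi f)) = a4.
  apply: grow f4 => v; rewrite Pf ffunE; case: ifP => _ E.
    by rewrite E eqxx in a21.
  by move: E; case: ifP => // _ E; rewrite E eqxx in a32.
by rewrite -[6]/(4 + 2) iterD; apply: big_of_two Pg _; rewrite Pf.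
Qed.

Lemma big_setT : big setT.
Proof.
move=> d s _; rewrite -[RHS]Psi_const; congr Psi; apply/ffunP=> v.
by rewrite !ffunE inE.
Qed.

Lemma not_big_set0 : ~ big set0.
Proof.
move=> b0; have [|d _] := @fresh_colour [::] => //.
have [|s] := @fresh_colour [:: d] => //; rewrite inE => sd.
have := b0 s d sd; suff -> : two set0 s d = [ffun=> d].
  by rewrite Psi_const => E; rewrite E eqxx in sd.
by apply/ffunP=> v; rewrite !ffunE inE.
Qed.

Lemma iter_nbhd0 m : iter m (@nbhd G) set0 = set0.
Proof.
elim: m => //= m ->; apply/setP=> v; rewrite !inE.
by apply/existsP=> [[u]]; rewrite inE.
Qed.

(** Splitting off the sets of the cover one at a time costs radius six each. *)
Lemma big_cover (I : Type) (js : seq I) (B : I -> {set G}) m :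
    big (iter m (@nbhd G) (\bigcup_(j <- js) B j)) ->
  exists j, big (iter (6 * size js + m) (@nbhd G) (B j)).
Proof.
elim: js m => [|j js IHjs] m; first by rewrite big_nil iter_nbhd0 => /not_big_set0.
rewrite big_cons => /big_split /(_ (iter_nbhdU _ _ _))[bj|].
  exists j; rewrite (_ : _ + m = 6 * size js + (6 + m)); last by rewrite /=; lia.
  by rewrite iterD iterD; apply: big_iter.
rewrite -iterD => /IHjs[i bi]; exists i.
by rewrite (_ : _ + m = 6 * size js + (6 + m)) //=; lia.
Qed.

Lemma big_not_bipartite X (side : G -> bool) :
    (forall u v, u \in nbhd X -> v \in nbhd X -> edge u v -> side u != side v) ->
  ~ big X.
Proof.
move=> sideP bX.
have [|p _] := @fresh_colour [::] => //.
have [|q] := @fresh_colour [:: p] => //; rewrite !inE => qp.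
pose mu t : {ffun G -> 'I_c} :=
  [ffun v => if v \in nbhd X then if side v then p else q else t].
have Pmu t : t \notin [:: p; q] -> Psi (mu t) \in [:: p; q].
  rewrite !inE negb_or => /andP[tp tq].
  (* The big set [X] with colour [t] is adjacent to [mu t], where [t] occurs
     only outside the neighbourhood of [X]. *)
  have [|e] := @fresh_colour [:: p; q; t] => //.
  rewrite !inE !negb_or => /and3P[ep eq et].
  have: Psi (mu t) != Psi (two X t e).
    apply: Psi_proper; apply/exp_edgeP=> u v uv.
    rewrite !ffunE; case: (ifP (v \in X)) => [vX|_].
      rewrite (nbhd_edge vX) 1?edge_sym //.
      by case: ifP => _; rewrite eq_sym.
    by case: ifP => _; [case: ifP => _|]; rewrite eq_sym.
  rewrite bX 1?eq_sym //; have [v] := Psi_image (mu t).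
  rewrite {1}ffunE; case: ifP => _; last by move=> <-; rewrite eqxx.
  by case: ifP => _ <- _; rewrite eqxx ?orbT.
have mu_edge s t : s \notin [:: p; q] -> t \notin [:: p; q] -> s != t ->
    Psi (mu s) != Psi (mu t).
  rewrite !inE !negb_or => /andP[sp sq] /andP[tp tq] st.
  apply: Psi_proper; apply/exp_edgeP=> u v uv; rewrite !ffunE.
  case: (boolP (u \in nbhd X)) => uX; case: (boolP (v \in nbhd X)) => vX //.
  - have:= sideP u v uX vX uv.
    by case: (side u); case: (side v) => //= _; rewrite // eq_sym.
  - by case: ifP => _; rewrite eq_sym.
  - by case: ifP.
have [|t1 t1P] := @fresh_colour [:: p; q] => //.
have [|t2 t2P] := @fresh_colour [:: p; q; t1] => //.
have [|t3 t3P] := @fresh_colour [:: p; q; t1; t2] => //.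
have t2N : t2 \notin [:: p; q] by move: t2P; rewrite !inE !negb_or => /and3P[-> ->].
have t3N : t3 \notin [:: p; q] by move: t3P; rewrite !inE !negb_or => /and4P[-> ->].
have t21 : t2 != t1 by move: t2P; rewrite !inE !negb_or => /and3P[].
have [t31 t32] : t3 != t1 /\ t3 != t2.
  by move: t3P; rewrite !inE !negb_or => /and4P[].
have := mu_edge _ _ t2N t1P t21; have := mu_edge _ _ t3N t1P t31.
have := mu_edge _ _ t3N t2N t32.
have:= Pmu _ t1P; have:= Pmu _ t2N; have:= Pmu _ t3N; rewrite !inE.
by move=> /orP[]/eqP-> /orP[]/eqP-> /orP[]/eqP->; rewrite ?eqxx.
Qed.

End Localisation.

Lemma exp_graph_not_colorable (G : sgraph) c (ncol : ~~ colorable G c)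
    (J : finType) (B : J -> {set G}) (side : J -> G -> bool) :
    4 < c -> (forall v, exists j, v \in B j) ->
    (forall j u v, u \in iter (6 * #|J|).+1 (@nbhd G) (B j) -> edge u v ->
       side j u != side j v) ->
  ~~ colorable (exp_graph ncol) c.
Proof.
move=> c5 coverB sideP; apply/negP=> /existsP[Phi /forallP PhiP].
have Phi_proper f g : exp_edge f g -> Phi f != Phi g.
  by move: (forallP (PhiP f) g) => /implyP.
(* The constant maps form a clique, so [Phi] permutes the colours on them. *)
pose pi d := Phi [ffun=> d].
have pi_inj : injective pi.
  move=> d s /eqP; apply: contraTeq => ds; apply: Phi_proper.
  by apply/exp_edgeP=> u v _; rewrite !ffunE.
pose Psi f := invF pi_inj (Phi f).
have Psi_proper f g : exp_edge f g -> Psi f != Psi g.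
  by move/Phi_proper; rewrite (inj_eq (can_inj (f_invF pi_inj))).
have Psi_const d : Psi [ffun=> d] = d by rewrite /Psi -/(pi d) invF_f.
have bT : big Psi (iter 0 (@nbhd G) (\bigcup_(j <- enum J) B j)).
  rewrite /= (_ : \bigcup_(j <- _) _ = setT); first exact: big_setT.
  apply/setP=> v; rewrite inE big_enum /=; apply/bigcupP.
  by have [j jv] := coverB v; exists j.
have [j] := big_cover c5 Psi_proper Psi_const bT.
rewrite addn0 -cardE; apply: (@big_not_bipartite _ _ c5 _ _ _ _ (side j)) => //.
by move=> u v; rewrite -iterS => uX _; apply: sideP.
Qed.

(** * Chromatic number and homomorphisms to complete graphs *)

Lemma colorable_leq (G : sgraph) m n : m <= n -> colorable G m -> colorable G n.
Proof.
move=> mn /existsP[f /forallP fP]; apply/existsP.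
exists [ffun u => widen_ord mn (f u)]; apply/forallP=> u; apply/forallP=> v.
apply/implyP=> uv; rewrite !ffunE -(inj_eq val_inj) /=.
by have /implyP/(_ uv) := forallP (fP u) v.
Qed.

Lemma ltn_chromatic (G : sgraph) c : ~~ colorable G c -> c < chromatic_number G.
Proof.
rewrite /chromatic_number; case: ex_minnP => m Gm _; apply: contraNltn => mc.
exact: colorable_leq Gm.
Qed.

Lemma chromatic_leq (G : sgraph) c : colorable G c -> chromatic_number G <= c.
Proof. by rewrite /chromatic_number; case: ex_minnP => m _; apply. Qed.

Lemma colorable_hom (G : sgraph) c :
  colorable G c <-> hom_exists G (complete_graph c).
Proof.
split=> [/existsP[f /forallP fP]|[f fP]].
  by exists f => u v uv; have /implyP/(_ uv) := forallP (fP u) v.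
apply/existsP; exists [ffun u => f u]; apply/forallP=> u; apply/forallP=> v.
by apply/implyP=> uv; rewrite !ffunE; apply: fP.
Qed.

Lemma tensor_exp_colorable (G : sgraph) c (ncol : ~~ colorable G c) :
  colorable (tensor G (exp_graph ncol)) c.
Proof.
apply/existsP; exists [ffun p : tensor G (exp_graph ncol) => p.2 p.1].
apply/forallP=> -[u f]; apply/forallP=> -[v g]; rewrite !ffunE /=.
by apply/implyP=> /andP[/= uv /exp_edgeP]; apply.
Qed.

(** * Counterexamples to Hedetniemi's conjecture *)

Lemma hedetniemi_counterexample c : 4 < c ->
  exists G H : sgraph,
    [/\ ~~ colorable G c, ~~ colorable H c & colorable (tensor G H) c].
Proof.
move=> c5; have c0 : 0 < c by apply: leq_trans c5.
(* [r] is the radius needed to split the cover by [c] parts. *)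
pose r := (6 * #|'I_c|).+1; pose l := (2 * (r + 1) * c).+1.
have ncol := @block_graph_ncol c l (ltn0Sn _) c0.
exists (block_graph c (ltn0Sn _ : 0 < l)), (exp_graph ncol).
split; [exact: ncol | | exact: tensor_exp_colorable].
apply: (@exp_graph_not_colorable _ c ncol _ (part _) (@side c l _)) => //.
  exact: part_cover.
by move=> j u v; apply: side_edge.
Qed.

Theorem mainTheorem2 (c k n : nat)
  (hc : 0 < c) (hk : 0 < k) (hn : 0 < n)
  (hcn : n + 1 <= c) (hck : 2 * k + 1 <= c) (hc5 : 5 <= c)
  (hnk : c + 1 <= n * k) :
  ~ multiplicative (complete_graph c) /\
  exists G H : sgraph,
    [/\ c < chromatic_number G,
        c < chromatic_number H &
        chromatic_number (tensor G H) <= c].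
Proof.
have [G [H [nG nH GH]]] := hedetniemi_counterexample hc5.
split.
  move=> /(_ G H (proj1 (colorable_hom _ _) GH)).
  by case=> /colorable_hom; apply/negP.
by exists G, H; split; [apply: ltn_chromatic | apply: ltn_chromatic | apply: chromatic_leq].
Qed.
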